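(* Let $\mathsf A$ and $\mathsf B$ be two categories, and let $\Phi\colon\mathsf B\rightleftarrows\mathsf A\,:\!\Psi$ be a pair of adjoint functors, where $\Psi\colon\mathsf A\to\mathsf B$ is the right adjoint, such that the restrictions of $\Phi$ and $\Psi$ are mutually inverse equivalences between a full subcategory $\mathsf L\subset\mathsf A$ and a full subcategory $\mathsf P\subset\mathsf B$. Then: (a) a morphism $l\colon L\to N$ in $\mathsf A$ with $L\in\mathsf L$ is an $\mathsf L$-precover if and only if the morphism $\Psi(l)\colon\Psi(L)\to\Psi(N)$ is a $\mathsf P$-precover; (b) a morphism $l\colon L\to N$ in $\mathsf A$ with $L\in\mathsf L$ is an $\mathsf L$-cover if and only if the morphism $\Psi(l)\colon\Psi(L)\to\Psi(N)$ is a $\mathsf P$-cover; (c) an object $N\in\mathsf A$ has an $\mathsf L$-precover if and only if the object $\Psi(N)\in\mathsf B$ has a $\mathsf P$-precover; (d) an object $N\in\mathsf A$ has an $\mathsf L$-cover if and only if the object $\Psi(N)\in\mathsf B$ has a $\mathsf P$-cover.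
   Context: For a class of objects $\mathsf L$ in a category, a morphism $l\colon L\to C$ is an $\mathsf L$-precover (of $C$) if $L\in\mathsf L$ and every morphism $L'\to C$ with $L'\in\mathsf L$ factors through $l$; it is an $\mathsf L$-cover if moreover every endomorphism $e\colon L\to L$ with $le=l$ is an automorphism of $L$. For a full subcategory, the terms refer to its class of objects. *)

(* Defs.v *)
From mathcomp Require Import ssreflect ssrfun ssrbool eqtype.

Set Implicit Arguments.
Unset Strict Implicit.
Unset Printing Implicit Defensive.

Reserved Notation "g ∘ f" (at level 40, left associativity).

Record category := Category {
  obj :> Type;
  hom : obj -> obj -> Type;
  idm : forall X : obj, hom X X;
  comp : forall X Y Z : obj, hom Y Z -> hom X Y -> hom X Z;
  comp1m : forall (X Y : obj) (f : hom X Y), comp (idm Y) f = f;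
  compm1 : forall (X Y : obj) (f : hom X Y), comp f (idm X) = f;
  compmA : forall (X Y Z W : obj) (h : hom Z W) (g : hom Y Z) (f : hom X Y),
    comp h (comp g f) = comp (comp h g) f
}.

Arguments hom {c} X Y.
Arguments idm {c} X.
Arguments comp {c X Y Z} g f.

Notation "g ∘ f" := (comp g f).

Definition is_iso (C : category) (X Y : C) (f : hom X Y) : Prop :=
  exists g : hom Y X, g ∘ f = idm X /\ f ∘ g = idm Y.

Record functor (C D : category) := Functor {
  fobj :> C -> D;
  fmap : forall X Y : C, hom X Y -> hom (fobj X) (fobj Y);
  fmap1 : forall X : C, fmap (idm X) = idm (fobj X);
  fmapM : forall (X Y Z : C) (g : hom Y Z) (f : hom X Y),
    fmap (g ∘ f) = fmap g ∘ fmap f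
}.

Arguments fmap {C D} F {X Y} f : rename.

Definition id_functor (C : category) : functor C C :=
  @Functor C C (fun X => X) (fun X Y f => f)
    (fun X => erefl) (fun X Y Z g f => erefl).

Lemma comp_functor_fmap1 (C D E : category) (G : functor D E) (F : functor C D)
  (X : C) : fmap G (fmap F (idm X)) = idm (G (F X)).
Proof. by rewrite !fmap1. Qed.

Lemma comp_functor_fmapM (C D E : category) (G : functor D E) (F : functor C D)
  (X Y Z : C) (g : hom Y Z) (f : hom X Y) :
  fmap G (fmap F (g ∘ f)) = fmap G (fmap F g) ∘ fmap G (fmap F f).
Proof. by rewrite !fmapM. Qed.

Definition comp_functor (C D E : category) (G : functor D E) (F : functor C D) :
    functor C E :=
  @Functor C E (fun X => G (F X)) (fun X Y f => fmap G (fmap F f))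
    (@comp_functor_fmap1 C D E G F) (@comp_functor_fmapM C D E G F).

Definition naturally_isomorphic (C D : category) (F G : functor C D) : Prop :=
  exists alpha : forall X : C, hom (F X) (G X),
    (forall (X Y : C) (f : hom X Y), alpha Y ∘ fmap F f = fmap G f ∘ alpha X)
    /\ (forall X : C, is_iso (alpha X)).

Definition mutually_inverse_equivalences (C D : category)
    (F : functor C D) (G : functor D C) : Prop :=
  naturally_isomorphic (comp_functor G F) (id_functor C)
  /\ naturally_isomorphic (comp_functor F G) (id_functor D).

(* F is the left adjoint: hom (F X) Y is in natural bijection with
   hom X (G Y). *)
Record adjunction (C D : category) (F : functor C D) (G : functor D C) :=
  Adjunction {
  adj : forall (X : C) (Y : D), hom (F X) Y -> hom X (G Y);
  adjV : forall (X : C) (Y : D), hom X (G Y) -> hom (F X) Y;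
  adjK : forall (X : C) (Y : D), cancel (@adj X Y) (@adjV X Y);
  adjVK : forall (X : C) (Y : D), cancel (@adjV X Y) (@adj X Y);
  adj_natural_l : forall (X X' : C) (Y : D) (u : hom X' X) (f : hom (F X) Y),
    adj (f ∘ fmap F u) = adj f ∘ u;
  adj_natural_r : forall (X : C) (Y Y' : D) (v : hom Y Y') (f : hom (F X) Y),
    adj (v ∘ f) = fmap G v ∘ adj f
}.

(* A full subcategory is given by its class of objects, which need not be
   closed under isomorphism. *)
Definition full_subcategory (C : category) (P : C -> Prop) : category :=
  @Category {X : C | P X} (fun X Y => hom (sval X) (sval Y))
    (fun X => idm (sval X)) (fun X Y Z g f => g ∘ f)
    (fun X Y f => comp1m f) (fun X Y f => compm1 f)
    (fun X Y Z W h g f => compmA h g f).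

Definition restrict_functor (C D : category) (F : functor C D)
    (P : C -> Prop) (Q : D -> Prop) (FPQ : forall X : C, P X -> Q (F X)) :
    functor (full_subcategory P) (full_subcategory Q) :=
  @Functor (full_subcategory P) (full_subcategory Q)
    (fun X => exist Q (F (sval X)) (FPQ (sval X) (svalP X)))
    (fun X Y f => fmap F f)
    (fun X => fmap1 F (sval X)) (fun X Y Z g f => fmapM F g f).

Definition is_precover (C : category) (L : C -> Prop) (X N : C) (l : hom X N) :
    Prop :=
  L X /\ forall (X' : C) (f : hom X' N), L X' -> exists g : hom X' X, f = l ∘ g.

Definition is_cover (C : category) (L : C -> Prop) (X N : C) (l : hom X N) :
    Prop :=
  is_precover L l /\ forall e : hom X X, l ∘ e = l -> is_iso e.

Definition has_precover (C : category) (L : C -> Prop) (N : C) : Prop :=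
  exists (X : C) (l : hom X N), is_precover L l.

Definition has_cover (C : category) (L : C -> Prop) (N : C) : Prop :=
  exists (X : C) (l : hom X N), is_cover L l.

(* Main.v *)
Require Import Defs.
From mathcomp Require Import ssreflect ssrfun ssrbool eqtype.

Set Implicit Arguments.
Unset Strict Implicit.
Unset Printing Implicit Defensive.

(** The hypothesis provides some natural isomorphisms [Psi Phi ~ id] on [P] and
    [Phi Psi ~ id] on [L], which need not be the unit and the counit of the
    adjunction.  The argument is arranged so that the comparison with the unit
    and the counit is never made.  Only two consequences of the equivalence are
    used: [Phi] is full on [P] and [Psi] is full on [L] ([equivalence_full]),
    and every [X] in [L] is isomorphic to [Phi (Psi X)], hence to an object in
    the image of [P].

    By the second fact, morphisms out of an object [X] of [L] into an arbitrary
    [N] are controlled by the adjunction: if [b : Phi (Psi X) -> X] is an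
    isomorphism, then [adj (f ∘ b) = Psi f ∘ adj b], so [Psi f] determines [f]
    ([radj_faithful]).  Together with fullness of [Psi] on [L], this makes
    factorizations of [f] through [l] the same thing as factorizations of
    [Psi f] through [Psi l], for [f] with source in [L], and makes endomorphisms
    of [X] over [N] the same thing as endomorphisms of [Psi X] over [Psi N].
    The objects of [P] that are not of the form [Psi X] are handled by
    transposition along the adjunction.

    For existence, a [P]-precover [p : Y -> Psi N] is transposed to
    [adjV p : Phi Y -> N], which is an [L]-precover
    ([transpose_precover]); an endomorphism of [Phi Y] over [N] is the image
    under [Phi] of an endomorphism of [Y] over [Psi N], so covers go to covers
    ([transpose_cover]). *)

(** * Isomorphisms and equivalences *)

Lemma iso_cancel_r (C : category) (X Y Z : C) (f : hom X Y) (g1 g2 : hom Y Z) :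
  is_iso f -> g1 ∘ f = g2 ∘ f -> g1 = g2.
Proof.
move=> [h [_ fh]] eqg.
by rewrite -(compm1 g1) -(compm1 g2) -fh !compmA eqg.
Qed.

Lemma iso_cancel_l (C : category) (X Y Z : C) (f : hom Y Z) (g1 g2 : hom X Y) :
  is_iso f -> f ∘ g1 = f ∘ g2 -> g1 = g2.
Proof.
move=> [h [hf _]] eqg.
by rewrite -(comp1m g1) -(comp1m g2) -hf -!compmA eqg.
Qed.

Lemma fmap_iso (C D : category) (F : functor C D) (X Y : C) (f : hom X Y) :
  is_iso f -> is_iso (fmap F f).
Proof.
move=> [g [gf fg]]; exists (fmap F g).
by rewrite -!fmapM gf fg !fmap1.
Qed.

Lemma equivalence_sym (C D : category) (F : functor C D) (G : functor D C) :
  mutually_inverse_equivalences F G -> mutually_inverse_equivalences G F.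
Proof. by case. Qed.

(** Naturality of [a : G F ~ id] reads [a Y ∘ G (F f) = f ∘ a X], and [a X] can
    be cancelled. *)
Lemma left_inverse_faithful (C D : category) (F : functor C D)
    (G : functor D C) :
  naturally_isomorphic (comp_functor G F) (id_functor C) ->
  forall (X Y : C) (f1 f2 : hom X Y), fmap F f1 = fmap F f2 -> f1 = f2.
Proof.
move=> [a [nat_a iso_a]] X Y f1 f2 eqF; apply: (iso_cancel_r (iso_a X)).
by have /= <- := nat_a _ _ f1; have /= <- := nat_a _ _ f2; rewrite eqF.
Qed.

Lemma equivalence_full (C D : category) (F : functor C D) (G : functor D C) :
  mutually_inverse_equivalences F G ->
  forall (X Y : C) (g : hom (F X) (F Y)), exists f : hom X Y, fmap F f = g.
Proof.
move=> [[a [nat_a iso_a]] FG] X Y g.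
have [a' [a'a aa']] := iso_a X.
exists (a Y ∘ fmap G g ∘ a').
(* [G] is faithful, and the conjugate of [G g] by [a] was chosen so that [G F]
   sends it to [G g]. *)
apply: (left_inverse_faithful FG); apply: (iso_cancel_l (iso_a Y)).
have /= -> := nat_a _ _ (a Y ∘ fmap G g ∘ a').
by rewrite -compmA a'a compm1.
Qed.

(** The two subcategories are full, so fullness of the restricted functor is a
    statement about all morphisms of the ambient category. *)
Lemma restricted_equivalence_full (C D : category) (F : functor C D)
    (G : functor D C) (P : C -> Prop) (Q : D -> Prop)
    (FPQ : forall X : C, P X -> Q (F X)) (GQP : forall Y : D, Q Y -> P (G Y)) :
  mutually_inverse_equivalences (restrict_functor FPQ) (restrict_functor GQP) ->
  forall X Y : C, P X -> P Y ->
  forall g : hom (F X) (F Y), exists f : hom X Y, fmap F f = g.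
Proof.
move=> FG X Y PX PY g.
exact: (equivalence_full FG (X := exist P X PX) (Y := exist P Y PY) g).
Qed.

Lemma restricted_equivalence_iso (C D : category) (F : functor C D)
    (G : functor D C) (P : C -> Prop) (Q : D -> Prop)
    (FPQ : forall X : C, P X -> Q (F X)) (GQP : forall Y : D, Q Y -> P (G Y)) :
  mutually_inverse_equivalences (restrict_functor FPQ) (restrict_functor GQP) ->
  forall Y : D, Q Y -> exists b : hom (F (G Y)) Y, is_iso b.
Proof.
move=> [_ [b [_ iso_b]]] Y QY.
by exists (b (exist Q Y QY)); apply: (iso_b (exist Q Y QY)).
Qed.

(** * Transposition along the adjunction *)

Lemma adjV_natural_l (C D : category) (F : functor C D) (G : functor D C)
    (FG : adjunction F G) (X X' : C) (Y : D) (u : hom X' X) (f : hom X (G Y)) :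
  adjV FG (f ∘ u) = adjV FG f ∘ fmap F u.
Proof. by apply: (can_inj (@adjK _ _ _ _ FG _ _)); rewrite adj_natural_l !adjVK. Qed.

(** Precomposing with [b] and transposing turns [f] into [G f ∘ adj b], which
    depends on [G f] only. *)
Lemma radj_faithful (C D : category) (F : functor C D) (G : functor D C)
    (FG : adjunction F G) (X N : D) (b : hom (F (G X)) X) :
  is_iso b -> forall f1 f2 : hom X N, fmap G f1 = fmap G f2 -> f1 = f2.
Proof.
move=> iso_b f1 f2 eqG; apply: (iso_cancel_r iso_b).
by apply: (can_inj (@adjK _ _ _ _ FG _ _)); rewrite !adj_natural_r eqG.
Qed.

(** A test morphism [f : Y -> G N] factors through [G l] as soon as its
    transpose [F Y -> N] factors through [l]. *)
Lemma radj_precover (C D : category) (F : functor C D) (G : functor D C)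
    (FG : adjunction F G) (P : C -> Prop) (L : D -> Prop)
    (FPL : forall Y : C, P Y -> L (F Y)) (GLP : forall X : D, L X -> P (G X))
    (X N : D) (l : hom X N) :
  is_precover L l -> is_precover P (fmap G l).
Proof.
move=> [LX lP]; split; first exact: GLP.
move=> Y f PY; have [g fE] := lP _ (adjV FG f) (FPL _ PY).
by exists (adj FG g); rewrite -adj_natural_r -fE adjVK.
Qed.

Section AdjunctionRestrictingToEquivalence.

Variables (A B : category) (Phi : functor B A) (Psi : functor A B).
Variables (PhiPsi : adjunction Phi Psi) (L : A -> Prop) (P : B -> Prop).
Hypotheses (PhiPL : forall X : B, P X -> L (Phi X))
  (PsiLP : forall X : A, L X -> P (Psi X)).
Hypothesis equivPL : mutually_inverse_equivalences
  (restrict_functor PhiPL) (restrict_functor PsiLP).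

Lemma Psi_faithful (X N : A) (f1 f2 : hom X N) :
  L X -> fmap Psi f1 = fmap Psi f2 -> f1 = f2.
Proof.
move=> LX; have [b iso_b] := restricted_equivalence_iso equivPL LX.
exact: (radj_faithful PhiPsi iso_b).
Qed.

Lemma Psi_full (X X' : A) (g : hom (Psi X) (Psi X')) :
  L X -> L X' -> exists f : hom X X', fmap Psi f = g.
Proof.
by move=> LX LX'; apply: (restricted_equivalence_full (equivalence_sym equivPL)).
Qed.

Lemma Psi_reflects_iso (X X' : A) (f : hom X X') :
  L X -> L X' -> is_iso (fmap Psi f) -> is_iso f.
Proof.
move=> LX LX' [g [gf fg]]; have [h hE] := Psi_full g LX' LX.
by exists h; split; apply: Psi_faithful => //; rewrite fmapM fmap1 hE.
Qed.

(** * Precovers and covers under the right adjoint *)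

Lemma Psi_precover (X N : A) (l : hom X N) :
  L X -> is_precover L l <-> is_precover P (fmap Psi l).
Proof.
move=> LX; split; first exact: (radj_precover PhiPsi PhiPL PsiLP).
move=> [_ lP]; split=> // X' f LX'.
have [g fE] := lP _ (fmap Psi f) (PsiLP LX').
have [h hE] := Psi_full g LX' LX.
by exists h; apply: Psi_faithful; rewrite // fmapM hE.
Qed.

(** [Psi] identifies the endomorphisms of [X] over [N] with those of [Psi X]
    over [Psi N], and it preserves and reflects invertibility. *)
Lemma Psi_cover (X N : A) (l : hom X N) :
  L X -> is_cover L l <-> is_cover P (fmap Psi l).
Proof.
move=> LX; split=> -[lP l_min]; split; try exact/Psi_precover.
- move=> e; have [h <-] := Psi_full e LX LX.
  rewrite -fmapM => /(Psi_faithful LX) lh.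
  exact/fmap_iso/l_min.
- move=> e le; apply: Psi_reflects_iso => //; apply: l_min.
  by rewrite -fmapM le.
Qed.

(** * Transposing precovers and covers back *)

(** Let [b : Phi (Psi X') -> X'] be an isomorphism.  If [Psi f = p ∘ g], then
    the transpose of [f ∘ b] is [p ∘ (g ∘ adj b)], so that [f ∘ b] factors
    through [adjV p]. *)
Lemma transpose_precover (Y : B) (N : A) (p : hom Y (Psi N)) :
  is_precover P p -> is_precover L (adjV PhiPsi p).
Proof.
move=> [PY pP]; split; first exact: PhiPL.
move=> X' f LX'; have [g fE] := pP _ (fmap Psi f) (PsiLP LX').
have [b [b' [_ bb']]] := restricted_equivalence_iso equivPL LX'.
exists (fmap Phi (g ∘ adj PhiPsi b) ∘ b').
rewrite compmA -adjV_natural_l compmA -fE -adj_natural_r adjK.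
by rewrite -compmA bb' compm1.
Qed.

(** Since [Phi] is full on [P], an endomorphism of [Phi Y] is [Phi h]; if it
    fixes [adjV p], then transposing back shows that [h] fixes [p]. *)
Lemma transpose_cover (Y : B) (N : A) (p : hom Y (Psi N)) :
  is_cover P p -> is_cover L (adjV PhiPsi p).
Proof.
move=> [pP p_min]; split; first exact: transpose_precover.
have [PY _] := pP; move=> e.
have [h <-] := restricted_equivalence_full equivPL PY PY e.
rewrite -adjV_natural_l => /(can_inj (@adjVK _ _ _ _ PhiPsi _ _)) ph.
exact/fmap_iso/p_min.
Qed.

End AdjunctionRestrictingToEquivalence.

Theorem proposition5p4 (A B : category)
  (Phi : functor B A) (Psi : functor A B) (PhiPsi : adjunction Phi Psi)
  (L : A -> Prop) (P : B -> Prop)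
  (PhiPL : forall X : B, P X -> L (Phi X))
  (PsiLP : forall X : A, L X -> P (Psi X))
  (equivPL : mutually_inverse_equivalences
     (restrict_functor PhiPL) (restrict_functor PsiLP)) :
  (forall (X N : A) (l : hom X N), L X ->
     (is_precover L l <-> is_precover P (fmap Psi l)))
  /\ (forall (X N : A) (l : hom X N), L X ->
     (is_cover L l <-> is_cover P (fmap Psi l)))
  /\ (forall N : A, has_precover L N <-> has_precover P (Psi N))
  /\ (forall N : A, has_cover L N <-> has_cover P (Psi N)).
Proof.
have precoverE := Psi_precover PhiPsi equivPL.
have coverE := Psi_cover PhiPsi equivPL.
split; first exact: precoverE.
split; first exact: coverE.
split=> N; split.
- move=> [X [l lP]]; exists (Psi X), (fmap Psi l).
  by apply/precoverE => //; case: lP.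
- move=> [Y [p pP]]; exists (Phi Y), (adjV PhiPsi p).
  exact: (transpose_precover PhiPsi equivPL).
- move=> [X [l lP]]; exists (Psi X), (fmap Psi l).
  by apply/coverE => //; case: lP => -[].
- move=> [Y [p pP]]; exists (Phi Y), (adjV PhiPsi p).
  exact: (transpose_cover PhiPsi equivPL).
Qed.
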